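(* Let $A\in\mathbb{R}^{p\times n}$ and $B\in\mathbb{R}^{p\times m}$ satisfy $\operatorname{rge} B\subset \operatorname{rge} A$, and let $$\Omega(A,B)=\left\{(Y,W)\in\mathbb{R}^{n\times m}\times\mathbb{S}^n \;\middle|\; AY=B\ \text{ and }\ \tfrac12 YY^T+W\in\mathcal{K}_A^\circ\right\}.$$ Then the following hold: (a) $\operatorname{rint}\Omega(A,B)=\left\{(Y,W)\in\mathbb{R}^{n\times m}\times\mathbb{S}^n\;\middle|\; AY=B\ \text{ and }\ \tfrac12 YY^T+W\in\operatorname{rint}(\mathcal{K}_A^\circ)\right\}.$ (b) $\operatorname{aff}\Omega(A,B)=\left\{(Y,W)\in\mathbb{R}^{n\times m}\times\mathbb{S}^n\;\middle|\; AY=B\ \text{ and }\ \tfrac12 YY^T+W\in\operatorname{span}\mathcal{K}_A^\circ\right\},$ where $\operatorname{span}\mathcal{K}_A^\circ=\operatorname{span}\{vv^T\mid v\in\ker A\}$.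
   Context: $\mathbb{S}^n$ is the space of real symmetric $n\times n$ matrices with inner product $\langle V,W\rangle=\mathrm{tr}(VW)$. $\operatorname{rge}$ denotes the range (column space). $\mathcal{K}_A:=\{V\in\mathbb{S}^n \mid u^TVu\ge 0\ \text{for all } u\in\ker A\}$ and $\mathcal{K}_A^\circ:=\{W\in\mathbb{S}^n\mid \langle W,V\rangle\le 0\ \text{for all } V\in\mathcal{K}_A\}$ is its polar cone. $\operatorname{aff}$ denotes the affine hull, $\operatorname{span}$ the linear span, and $\operatorname{rint}C$ the relative interior of a convex set $C$ (interior relative to $\operatorname{aff} C$). *)

(* Defs.v *)
From HB Require Import structures.
From mathcomp Require Import all_boot all_order all_algebra.
From mathcomp Require Import all_classical all_reals all_analysis.

Set Implicit Arguments.
Unset Strict Implicit.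
Unset Printing Implicit Defensive.

Import Order.TTheory GRing.Theory Num.Theory.
Import numFieldNormedType.Exports.

Local Open Scope classical_set_scope.
Local Open Scope ring_scope.

Definition lin_span (R : realType) (V : lmodType R) (C : set V) : set V :=
  [set x | exists (k : nat) (t : 'I_k -> R) (v : 'I_k -> V),
     (forall i, C (v i)) /\ x = \sum_(i < k) t i *: v i].

Definition aff_hull (R : realType) (V : lmodType R) (C : set V) : set V :=
  [set x | exists (k : nat) (t : 'I_k -> R) (v : 'I_k -> V),
     [/\ forall i, C (v i), \sum_(i < k) t i = 1
       & x = \sum_(i < k) t i *: v i]].

Definition rint (R : realType) (V : normedModType R) (C : set V) : set V :=
  @interior (subspace (aff_hull C)) C.

(* The space of symmetric matrices is a linear subspace of 'M[R]_n: its spans,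
   affine hulls and relative interiors do not depend on whether they are
   computed in it or in 'M[R]_n. *)
Definition sym_mx (R : realType) (n : nat) : set 'M[R]_n :=
  [set W | W^T = W].

Definition polar_sym (R : realType) (n : nat) (C : set 'M[R]_n)
    : set 'M[R]_n :=
  [set W | sym_mx W /\ forall V, C V -> \tr (W *m V) <= 0].

Section KOmega.
Variables (R : realType) (p n m : nat).

Definition col_ker (A : 'M[R]_(p, n)) : set 'cV[R]_n :=
  [set u | A *m u = 0].

Definition col_range (A : 'M[R]_(p, n)) : set 'cV[R]_p :=
  range (fun u : 'cV[R]_n => A *m u).

Definition K_ (A : 'M[R]_(p, n)) : set 'M[R]_n :=
  [set V | sym_mx V /\
           forall u, col_ker A u -> 0 <= (u^T *m V *m u) ord0 ord0].

Definition Omega (A : 'M[R]_(p, n)) (B : 'M[R]_(p, m))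
    : set ('M[R]_(n, m) * 'M[R]_n) :=
  [set YW | [/\ sym_mx YW.2, A *m YW.1 = B
     & polar_sym (K_ A) (2^-1 *: (YW.1 *m YW.1^T) + YW.2)]].

End KOmega.

(* Main.v *)
Require Import Defs.
From mathcomp Require Import all_boot all_order all_algebra.
From mathcomp Require Import all_classical all_reals all_analysis.

Set Implicit Arguments.
Unset Strict Implicit.
Unset Printing Implicit Defensive.

Import Order.TTheory GRing.Theory Num.Theory.
Import numFieldNormedType.Exports.
Local Open Scope classical_set_scope.
Local Open Scope ring_scope.

(** The condition [A (Y Y^T / 2 + W) = 0] is quadratic in [Y], but on
    [A Y = B] it reads [B Y^T / 2 + A W = 0] and becomes affine.  Since the span
    of the polar cone is [{N symmetric | A N = 0}], this makes the right-hand
    side of (b) an affine set, hence containing the affine hull; the reverse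
    inclusion only moves [W] along a fixed [Y].  For (a), relative interiors are
    transported by the continuous maps [(Y, W) |-> Y Y^T / 2 + W] and
    [N |-> (Y, N - Y Y^T / 2)], which exchange the sets and their hulls. *)

(** * Linear spans and affine hulls *)

Lemma lin_span0 (R : realType) (V : lmodType R) (C : set V) : lin_span C 0.
Proof.
by exists 0, (fun=> 0), (fun=> 0); split=> [[]//|]; rewrite big_ord0.
Qed.

Lemma lin_spanZ (R : realType) (V : lmodType R) (C : set V) (a : R) (x : V) :
  lin_span C x -> lin_span C (a *: x).
Proof.
move=> [k [t [v [Cv ->]]]]; exists k, (fun i => a * t i), v; split=> //.
by rewrite scaler_sumr; apply: eq_bigr => i _; rewrite scalerA.
Qed.

Lemma lin_spanD (R : realType) (V : lmodType R) (C : set V) (x y : V) :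
  lin_span C x -> lin_span C y -> lin_span C (x + y).
Proof.
move=> [k [t [v [Cv ->]]]] [l [s [w [Cw ->]]]].
exists (k + l)%N,
  (fun i => match fintype.split i with inl j => t j | inr j => s j end),
  (fun i => match fintype.split i with inl j => v j | inr j => w j end).
split=> [i|]; first by case: fintype.split.
rewrite big_split_ord /=; congr (_ + _); apply: eq_bigr => i _.
  by rewrite -[lshift l i]/(unsplit (inl i)) unsplitK.
by rewrite -[rshift k i]/(unsplit (inr i)) unsplitK.
Qed.

Lemma lin_span_sum (R : realType) (V : lmodType R) (C : set V) (I : finType)
    (t : I -> R) (v : I -> V) :
  (forall i, lin_span C (v i)) -> lin_span C (\sum_i t i *: v i).
Proof.
move=> Cv; apply: (big_ind (lin_span C)) => [|x y|i _].
- exact: lin_span0.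
- exact: lin_spanD.
- exact/lin_spanZ/Cv.
Qed.

Lemma sub_lin_span (R : realType) (V : lmodType R) (C : set V) :
  C `<=` lin_span C.
Proof.
move=> x Cx; exists 1%N, (fun=> 1), (fun=> x); split=> //.
by rewrite big_ord1 scale1r.
Qed.

Lemma lin_span_sub (R : realType) (V : lmodType R) (C D : set V) :
  C `<=` lin_span D -> lin_span C `<=` lin_span D.
Proof.
by move=> CD _ [k [t [v [Cv ->]]]]; apply: lin_span_sum => i; apply/CD/Cv.
Qed.

Lemma sub_aff_hull (R : realType) (V : lmodType R) (C : set V) :
  C `<=` aff_hull C.
Proof.
move=> x Cx; exists 1%N, (fun=> 1), (fun=> x).
by split=> //; rewrite big_ord1 ?scale1r.
Qed.

Lemma aff_hull_lin_span (R : realType) (V : lmodType R) (C : set V) :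
  C 0 -> aff_hull C = lin_span C.
Proof.
move=> C0; apply/seteqP; split=> x.
  by move=> [k [t [v [Cv _ ->]]]]; exists k, t, v.
move=> [k [t [v [Cv ->]]]].
(* The new index [ord0] carries the point 0 of [C] with the weight missing from 1; this corrects the
   total weight and leaves the combination unchanged. *)
exists k.+1, (oapp t (1 - \sum_i t i) \o unlift ord0), (oapp v 0 \o unlift ord0).
split=> [i||] /=.
- by case: unliftP => [j _|_] //=.
- rewrite big_ord_recl unlift_none /=.
  by under [X in _ + X]eq_bigr do rewrite liftK; rewrite subrK.
- rewrite big_ord_recl unlift_none /= scaler0 add0r.
  by apply: eq_bigr => i _; rewrite liftK.
Qed.

(** * Relative interiors *)

Lemma rintE (R : realType) (V : normedModType R) (C : set V) (x : V) :
  rint C x <-> aff_hull C x /\ within (aff_hull C) (nbhs x) C.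
Proof.
split=> [Cx|[Ax]]; last by rewrite nbhs_subspace_in.
(* Points off the hull are isolated in [subspace], so the description of neighborhoods by [within]
   requires first that [x] lie in the hull. *)
have Ax : aff_hull C x.
  by apply: sub_aff_hull; exact: (@interior_subset (subspace (aff_hull C)) C).
by split=> //; rewrite nbhs_subspace_in.
Qed.

(** Serves both inclusions of (a). A neighborhood of [f x] pulls back along [f], and the hypotheses
    on [f] concern only the hull of [C]; [f] need not be affine. *)
Lemma rint_preimage (R : realType) (V W : normedModType R) (C : set V)
    (D : set W) (f : V -> W) (x : V) :
  {for x, continuous f} ->
  (forall y, aff_hull C y -> aff_hull D (f y)) ->
  (forall y, aff_hull C y -> D (f y) -> C y) ->
  aff_hull C x -> rint D (f x) -> rint C x.
Proof.
move=> fx CD DC Cx /rintE[_ Dfx]; apply/rintE; split=> //.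
have := fx _ Dfx; rewrite /within /= => H.
near=> y => Cy; apply: DC => //.
by have : aff_hull D (f y) -> D (f y) by [near: y; exact: H]; apply; exact: CD.
Unshelve. all: by end_near. Qed.

(** * The polar cone of [K_ A] and its span *)

Lemma mxtrace_mulTmx_le0 (R : realDomainType) (m n : nat) (M : 'M[R]_(m, n)) :
  \tr (M^T *m M) <= 0 -> M = 0.
Proof.
have trE : \tr (M^T *m M) = \sum_j \sum_i M i j ^+ 2.
  by apply: eq_bigr => j _; rewrite mxE; apply: eq_bigr => i _; rewrite mxE expr2.
have sum_ge0 j : 0 <= \sum_i M i j ^+ 2 by apply: sumr_ge0 => i _; exact: sqr_ge0.
rewrite trE => tr_le0; apply/matrixP => i j; rewrite mxE.
have /eqP : \sum_j \sum_i M i j ^+ 2 = 0.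
  by apply/eqP; rewrite eq_le tr_le0 sumr_ge0.
rewrite psumr_eq0 // => /allP/(_ j (mem_index_enum j)).
rewrite psumr_eq0 => [|k _]; last exact: sqr_ge0.
by move=> /allP/(_ i (mem_index_enum i)); rewrite sqrf_eq0 => /eqP.
Qed.

Lemma mulmx_trmx_sum_col (R : comNzRingType) (m n : nat) (G : 'M[R]_(m, n))
    (W : 'M[R]_n) :
  G *m W *m G^T = \sum_i \sum_j W i j *: (col i G *m (col j G)^T).
Proof.
apply/matrixP => k l; rewrite mxE summxE.
under eq_bigr do rewrite mxE mulr_suml.
rewrite exchange_big; apply: eq_bigr => i _; rewrite summxE.
apply: eq_bigr => j _; rewrite !mxE big_ord1 !mxE.
by rewrite mulrA [W i j * _]mulrC.
Qed.

Section PolarCone.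
Variables (R : realType) (p n m : nat).
Implicit Types A : 'M[R]_(p, n).

Lemma polar_K0 A : polar_sym (K_ A) 0.
Proof. by split=> [|V _]; rewrite /sym_mx /= ?trmx0 // mul0mx mxtrace0. Qed.

(** By cyclicity of the trace, the pairing of [- (v *m v^T)] with [V] is the number $-v^T V v$. *)
Lemma polar_K_rank_one A (v : 'cV[R]_n) :
  col_ker A v -> polar_sym (K_ A) (- (v *m v^T)).
Proof.
move=> Av; split=> [|V [_ KV]].
  by rewrite /sym_mx /= linearN /= trmx_mul trmxK.
rewrite mulNmx raddfN /= -mulmxA mxtrace_mulC oppr_le0 /mxtrace big_ord1.
exact: KV.
Qed.

(* [V = A^T C + C^T A] vanishes as a quadratic form on [ker A], so it lies in
   [K_A]; for [C = A W] the inequality [tr (W V) <= 0] reads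
   [2 tr ((A W)^T (A W)) <= 0]. *)
Lemma polar_K_ker A (W : 'M[R]_n) : polar_sym (K_ A) W -> A *m W = 0.
Proof.
move=> [symW PW]; apply: mxtrace_mulTmx_le0; set C := A *m W.
have KV : K_ A (A^T *m C + C^T *m A).
  split=> [|u Au].
    by rewrite /sym_mx /= linearD /= !trmx_mul !trmxK addrC.
  have Au' : u^T *m A^T = 0 by rewrite -trmx_mul Au trmx0.
  by rewrite mulmxDr mulmxDl !mulmxA Au' !mul0mx add0r -!mulmxA Au !mulmx0 mxE.
have := PW _ KV; rewrite mulmxDr mxtraceD.
have -> : \tr (W *m (A^T *m C)) = \tr (C^T *m C).
  by rewrite [in RHS]/C trmx_mul symW mulmxA.
have -> : \tr (W *m (C^T *m A)) = \tr (C^T *m C).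
  by rewrite mxtrace_mulC -mulmxA.
by rewrite -mulr2n pmulrn_lle0.
Qed.

(* [W = G W G^T] for some [G] with columns [g_i] in [ker A]; symmetrizing and
   polarizing [\sum_(i, j) W i j g_i g_j^T] leaves only squares [v v^T]. *)
Lemma sym_ker_lin_span A (W : 'M[R]_n) :
  sym_mx W -> A *m W = 0 -> lin_span [set v *m v^T | v in col_ker A] W.
Proof.
move=> symW AW; set L := lin_span _.
have [G GA WG] : exists2 G : 'M[R]_n, A *m G = 0 & W = G *m W *m G^T.
  have sW : (W <= kermx A^T)%MS.
    by apply/sub_kermxP; rewrite -[W]symW -trmx_mul AW trmx0.
  (* The rows of [kermx A^T] span the transposed kernel of [A]. Right multiplication by $G^T$ fixes
     every matrix with rows in that space, so $W = W G^T$; transposing this gives $W = G W$ by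
     symmetry. *)
  exists (pinvmx (kermx A^T) *m kermx A^T)^T.
    by rewrite -[A in A *m _]trmxK -trmx_mul -mulmxA mulmx_ker mulmx0 trmx0.
  have WG : W *m pinvmx (kermx A^T) *m kermx A^T = W by rewrite mulmxKpV.
  rewrite trmxK -mulmxA [W *m (_ *m _)]mulmxA WG.
  by rewrite -[W in LHS]symW -[in LHS]WG -mulmxA trmx_mul symW.
have colG i : col_ker A (col i G) by rewrite /col_ker /= colE mulmxA GA mul0mx.
have LG u : col_ker A u -> L (u *m u^T).
  by move=> Au; apply: sub_lin_span; exists u.
have Lpol i j : L (col i G *m (col j G)^T + col j G *m (col i G)^T).
  have -> : forall u v : 'cV[R]_n, u *m v^T + v *m u^T =
      (u + v) *m (u + v)^T + (-1) *: (u *m u^T) + (-1) *: (v *m v^T).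
    move=> u v; rewrite !scaleN1r linearD /= mulmxDl !mulmxDr.
    by rewrite [RHS]addrAC !addrA addrK addrC !addrA addNr add0r.
  apply: lin_spanD; [apply: lin_spanD|].
  - by apply: LG; rewrite /col_ker /= mulmxDr !colG addr0.
  - exact/lin_spanZ/LG.
  - exact/lin_spanZ/LG.
(* The half comes from $W = (W + W^T)/2$; the factor [1 *:] gives the outer sum the shape of
   [lin_span_sum]. *)
have -> : W = \sum_i 1 *: \sum_j (2^-1 * W i j) *:
    (col i G *m (col j G)^T + col j G *m (col i G)^T).
  have W2 : W = 2^-1 *: (W + W^T).
    by rewrite symW -mulr2n -[W *+ 2]scaler_nat scalerA mulVf ?scale1r ?pnatr_eq0.
  rewrite [LHS]W2 [in LHS]WG mulmx_trmx_sum_col !raddf_sum -big_split scaler_sumr /=.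
  apply: eq_bigr => i _; rewrite raddf_sum -big_split scaler_sumr scale1r /=.
  apply: eq_bigr => j _.
  by rewrite linearZ /= trmx_mul trmxK -scalerDr scalerA.
apply: (lin_span_sum (fun=> 1)) => i; apply: lin_span_sum => j.
exact: Lpol.
Qed.

Lemma rank_one_sub_lin_span_polar_K A :
  [set v *m v^T | v in col_ker A] `<=` lin_span (polar_sym (K_ A)).
Proof.
move=> _ [v Av <-]; rewrite -[_ *m _]opprK -scaleN1r.
exact/lin_spanZ/sub_lin_span/polar_K_rank_one.
Qed.

(** Linear equations for the span make membership easy to test. They hold on the polar cone and pass
    to combinations; conversely their solutions are combinations of squares $vv^T$, whose negatives
    are polar. *)
Lemma lin_span_polar_KE A :
  lin_span (polar_sym (K_ A)) = [set W | sym_mx W /\ A *m W = 0].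
Proof.
apply/seteqP; split=> [_ [k [t [v [Pv ->]]]]|W [symW AW]].
  split; first rewrite /sym_mx /= raddf_sum; last rewrite mulmx_sumr big1 //.
    apply: eq_bigr => i _ /=; have [vT _] := Pv i.
    by rewrite linearZ /=; congr (_ *: _); exact: vT.
  by move=> i _; rewrite -scalemxAr polar_K_ker ?scaler0.
apply: lin_span_sub (sym_ker_lin_span symW AW).
exact: rank_one_sub_lin_span_polar_K.
Qed.

Lemma lin_span_polar_K_rank_one A :
  lin_span (polar_sym (K_ A)) = lin_span [set v *m v^T | v in col_ker A].
Proof.
apply/seteqP; split; first rewrite lin_span_polar_KE.
  by move=> W [symW AW]; exact: sym_ker_lin_span.
exact/lin_span_sub/rank_one_sub_lin_span_polar_K.
Qed.

End PolarCone.

(** * The affine hull of [Omega A B] *)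

Lemma half_gram_sym (R : realType) (n m : nat) (Y : 'M[R]_(n, m)) :
  sym_mx (2^-1 *: (Y *m Y^T)).
Proof. by rewrite /sym_mx /= linearZ /= trmx_mul trmxK. Qed.

Lemma aff_hull_Omega (R : realType) (p n m : nat)
    (A : 'M[R]_(p, n)) (B : 'M[R]_(p, m)) :
  aff_hull (Omega A B) =
    [set YW : 'M[R]_(n, m) * 'M[R]_n |
      [/\ sym_mx YW.2, A *m YW.1 = B
        & lin_span (polar_sym (K_ A)) (2^-1 *: (YW.1 *m YW.1^T) + YW.2)]].
Proof.
apply/seteqP; split=> [_ [k [t [v [Ov t1 ->]]]]|[Y W] /= [symW AY]].
  have fstE : (\sum_i t i *: v i).1 = \sum_i t i *: (v i).1.
    exact: (raddf_sum (fst : 'M[R]_(n, m) * 'M[R]_n -> _)).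
  have sndE : (\sum_i t i *: v i).2 = \sum_i t i *: (v i).2.
    exact: (raddf_sum (snd : 'M[R]_(n, m) * 'M[R]_n -> _)).
  have symW : sym_mx (\sum_i t i *: v i).2.
    rewrite /sym_mx /= sndE raddf_sum; apply: eq_bigr => i _ /=.
    by have [vT _ _] := Ov i; rewrite linearZ /=; congr (_ *: _); exact: vT.
  have AY : A *m (\sum_i t i *: v i).1 = B.
    rewrite fstE mulmx_sumr -[RHS]scale1r -t1 scaler_suml.
    by apply: eq_bigr => i _; have [_ Av _] := Ov i; rewrite -scalemxAr Av.
  split=> //; rewrite lin_span_polar_KE; split.
    by rewrite /sym_mx /= linearD /= half_gram_sym symW.
  (* Replacing $AY$ by $B$ makes the expression linear in $(Y, W)$, so it splits over the
     combination. In each term $B$ is then turned back into $AY_i$, and [polar_K_ker] kills the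
     term. *)
  rewrite mulmxDr -scalemxAr mulmxA AY fstE sndE raddf_sum /= !mulmx_sumr.
  rewrite scaler_sumr -big_split big1 //= => i _; have [_ Av Pv] := Ov i.
  rewrite linearZ /= -!scalemxAr scalerA mulrC -scalerA -scalerDr -{1}Av.
  by rewrite -mulmxA scalemxAr -mulmxDr polar_K_ker ?scaler0.
(* Passing to the affine hull provides weights of sum 1, so the constant $Y$ and the constant shift
   by $YY^T/2$ survive the combination. *)
rewrite -aff_hull_lin_span; last exact: polar_K0.
move=> [k [t [N [PN t1 NE]]]].
exists k, t, (fun i => (Y, N i - 2^-1 *: (Y *m Y^T))); split=> // [i|].
  split=> //=; last by rewrite addrC subrK.
  have [symN _] := PN i.
  by rewrite /sym_mx /= linearB /= half_gram_sym symN.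
rewrite [RHS]surjective_pairing; congr pair.
  rewrite (raddf_sum (fst : 'M[R]_(n, m) * 'M[R]_n -> _)) /=.
  by rewrite -scaler_suml t1 scale1r.
rewrite (raddf_sum (snd : 'M[R]_(n, m) * 'M[R]_n -> _)) /=.
under eq_bigr do rewrite scalerBr.
by rewrite sumrB -NE -scaler_suml t1 scale1r addrC addKr.
Qed.

(** * Continuity of matrix operations *)

Lemma cvg_mx (T : Type) (U : topologicalType) (m n : nat) (F : set_system T)
    (f : T -> 'M[U]_(m, n)) (M : 'M[U]_(m, n)) : Filter F ->
  (forall i j, f x i j @[x --> F] --> M i j) -> f x @[x --> F] --> M.
Proof.
move=> FF fM P [Q MQ QP]; rewrite /nbhs /=.
(* A basic neighborhood of [M] constrains each entry separately; as there are finitely many entries,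
   the constraints hold jointly along [F]. *)
suff FQ : \forall x \near F, forall i j, Q i j (f x i j).
  by apply: filterS FQ => x; exact: QP.
apply: filter_forall => i; apply: filter_forall => j.
exact: fM (MQ i j).
Qed.

Lemma cvg_coord (R : numFieldType) (T : Type) (m n : nat) (F : set_system T)
    (f : T -> 'M[R]_(m, n)) (M : 'M[R]_(m, n)) (i : 'I_m) (j : 'I_n) :
  Filter F -> f x @[x --> F] --> M -> f x i j @[x --> F] --> M i j.
Proof. by move=> FF fM; exact: (cvg_comp _ _ fM (@coord_continuous _ _ _ i j M)). Qed.

Lemma cvg_trmx (R : numFieldType) (T : Type) (m n : nat) (F : set_system T)
    (f : T -> 'M[R]_(m, n)) (M : 'M[R]_(m, n)) :
  Filter F -> f x @[x --> F] --> M -> (f x)^T @[x --> F] --> M^T.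
Proof.
move=> FF fM; apply: cvg_mx => i j; rewrite mxE.
by under eq_fun do rewrite mxE; exact: cvg_coord.
Qed.

Lemma cvg_mulmx (R : numFieldType) (T : Type) (m n k : nat) (F : set_system T)
    (f : T -> 'M[R]_(m, n)) (g : T -> 'M[R]_(n, k))
    (M : 'M[R]_(m, n)) (N : 'M[R]_(n, k)) : Filter F ->
  f x @[x --> F] --> M -> g x @[x --> F] --> N ->
  f x *m g x @[x --> F] --> M *m N.
Proof.
move=> FF fM gN; apply: cvg_mx => i j; rewrite mxE.
under eq_fun do rewrite mxE.
apply: cvg_big => [|l _]; first exact: add_continuous.
by apply: cvgM; exact: cvg_coord.
Qed.

Lemma continuous_pair_subr (R : numFieldType) (V W : normedModType R) (y : V)
    (c : W) : continuous (fun x => (y, x - c)).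
Proof.
move=> x; apply: cvg_pair => /=; first exact: cvg_cst.
by apply: cvgB; [exact: cvg_id|exact: cvg_cst].
Qed.

(** * The relative interior of [Omega A B] *)

Theorem proposition4p4 (R : realType) (p n m : nat)
    (A : 'M[R]_(p, n)) (B : 'M[R]_(p, m))
    (hBA : col_range B `<=` col_range A) :
  [/\ rint (Omega A B) =
        [set YW : 'M[R]_(n, m) * 'M[R]_n |
          [/\ sym_mx YW.2, A *m YW.1 = B
            & rint (polar_sym (K_ A))
                (2^-1 *: (YW.1 *m YW.1^T) + YW.2)]],
      aff_hull (Omega A B) =
        [set YW : 'M[R]_(n, m) * 'M[R]_n |
          [/\ sym_mx YW.2, A *m YW.1 = B
            & lin_span (polar_sym (K_ A))
                (2^-1 *: (YW.1 *m YW.1^T) + YW.2)]]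
    & lin_span (polar_sym (K_ A)) =
        lin_span [set v *m v^T | v in col_ker A]].
Proof.
split; [|exact: aff_hull_Omega|exact: lin_span_polar_K_rank_one].
have affP : aff_hull (polar_sym (K_ A)) = lin_span (polar_sym (K_ A)).
  by apply: aff_hull_lin_span; exact: polar_K0.
apply/seteqP; split=> [[Y W] rYW|[Y W] /= [symW AY rYW]].
  have [] := (rintE _ _).1 rYW; rewrite aff_hull_Omega /= => -[symW AY sYW] _.
  split=> //; move: rYW.
  (* With [Y] frozen, [f] sends the hull of the polar cone into that of [Omega A B], and [f N] lies
     in [Omega A B] only if [N] is polar. *)
  pose f (N : 'M[R]_n) : 'M[R]_(n, m) * 'M[R]_n := (Y, N - 2^-1 *: (Y *m Y^T)).
  have cf : continuous f by exact: continuous_pair_subr.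
  have -> : (Y, W) = f (2^-1 *: (Y *m Y^T) + W) by rewrite /f addrC addKr.
  apply: (@rint_preimage _ _ _ _ _ f).
  - exact: cf.
  - move=> N; rewrite affP aff_hull_Omega /f /= [_ + (N - _)]addrC subrK => sN; split=> //.
    have := sN; rewrite lin_span_polar_KE => -[symN _].
    by rewrite /sym_mx /= linearB /= half_gram_sym symN.
  - by move=> N _ [_ _]; rewrite /f /= addrC subrK.
  - by rewrite affP.
(* Here [Y] varies and [g] is quadratic; its compatibility with the hulls is supplied by (b). *)
pose g (YW : 'M[R]_(n, m) * 'M[R]_n) := 2^-1 *: (YW.1 *m YW.1^T) + YW.2.
have cg : continuous g.
  move=> YW; apply: cvgD; last exact: cvg_snd.
  apply: cvgZr; apply: cvg_mulmx; [exact: cvg_fst|].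
  by apply: cvg_trmx; exact: cvg_fst.
apply: (@rint_preimage _ _ _ _ _ g (Y, W) _ _ _ _ rYW).
- exact: cg.
- by move=> YW; rewrite affP aff_hull_Omega => -[].
- by move=> YW; rewrite aff_hull_Omega => -[].
- by rewrite aff_hull_Omega; split=> //; rewrite -affP; exact: ((rintE _ _).1 rYW).1.
Qed.
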